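(* Let $(M,\varphi,\xi,\eta,g)$ be a $3$-dimensional trans-Sasakian manifold of type $(\alpha,\beta)$ equipped with a Newman--Penrose frame $(\partial,\overline{\partial},\xi)$. Then the structure vector field $\xi$ is pointwise collinear with its rough Laplacian, that is, $\Delta_g\xi=\lambda\xi$ for some smooth function $\lambda$ on $M$, if and only if $\partial(\rho_{\mathrm{np}})=0$. Moreover, the corresponding function $\lambda$ is given by $\lambda=2|\rho_{\mathrm{np}}|^2$.
   Context: An almost contact metric structure $(\varphi,\xi,\eta,g)$ on $M$: $\varphi$ a $(1,1)$-tensor, $\xi$ a vector field, $\eta$ a $1$-form, $g$ a Riemannian metric with $\varphi^2=-I+\eta\otimes\xi$, $\eta(\xi)=1$, $\varphi\xi=0$, $\eta\circ\varphi=0$, $g(\varphi X,\varphi Y)=g(X,Y)-\eta(X)\eta(Y)$. It is trans-Sasakian of type $(\alpha,\beta)$ ($\alpha,\beta$ smooth functions) if $(\nabla_X\varphi)Y=\alpha(g(X,Y)\xi-\eta(Y)X)+\beta(g(\varphi X,Y)\xi-\eta(Y)\varphi X)$, with $\nabla$ the Levi-Civita connection. Newman--Penrose frame: for an orthonormal frame $(e_1,e_2,\xi)$, put $\partial=\frac1{\sqrt2}(e_1-ie_2)$, $\overline{\partial}=\frac1{\sqrt2}(e_1+ie_2)$, chosen so that $\varphi\partial=i\partial$, $\varphi\overline{\partial}=-i\overline{\partial}$ (i.e. $\varphi e_1=e_2$). All tensors and $\nabla$ are extended complex-(multi)linearly. Put $\sigma_{\mathrm{np}}=-g(\partial,\nabla_\partial\xi)$,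 $\rho_{\mathrm{np}}=g(\partial,\nabla_{\overline{\partial}}\xi)$, $\kappa_{\mathrm{np}}=-g(\partial,\nabla_\xi\xi)$. In these terms the trans-Sasakian condition of type $(\alpha,\beta)$ reads $\kappa_{\mathrm{np}}=\sigma_{\mathrm{np}}=0$, $\rho_{\mathrm{np}}=\beta+i\alpha$. For a function $f$, $\partial(f)$ denotes the derivative along $\partial$. Rough Laplacian of a vector field $X$ (with $e_3=\xi$): $\Delta_gX=-\sum_{i=1}^3\bigl(\nabla_{e_i}\nabla_{e_i}X-\nabla_{\nabla_{e_i}e_i}X\bigr)$. *)

(* Defs.v *)
From HB Require Import structures.
From mathcomp Require Import all_boot all_order all_algebra.
From mathcomp Require Import all_classical all_reals all_analysis.
From mathcomp Require Export complex.

Set Implicit Arguments.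
Unset Strict Implicit.
Unset Printing Implicit Defensive.

Import Order.TTheory GRing.Theory Num.Theory.
Import numFieldNormedType.Exports.

Local Open Scope classical_set_scope.
Local Open Scope ring_scope.

Section SmoothEuclidean.
Context {R : realType} {n : nat}.
Implicit Types (U : set 'rV[R]_n) (f g : 'rV[R]_n -> R).

Definition basis_vec (i : 'I_n) : 'rV[R]_n := delta_mx 0 i.

Definition continuous_in U f := forall x, U x -> {for x, continuous f}.

(* Only used for open U, so that the continuity and the differentiability of  *)
(* f at points of U depend on f only through its values on U.                 *)
Fixpoint Ck (k : nat) U f : Prop :=
  continuous_in U f /\
  if k is k'.+1 then
    forall i, (forall x, U x -> derivable f x (basis_vec i)) /\
              Ck k' U ('D_(basis_vec i) f)
  else True.

Definition smooth_on U f := forall k, Ck k U f.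

Lemma Ck_continuous k U f : Ck k U f -> continuous_in U f.
Proof. by case: k => [|k] []. Qed.

Lemma Ck_weaken k U f : Ck k.+1 U f -> Ck k U f.
Proof.
elim: k f => [|k IHk] f [fc fD]; first by split.
by split=> // i; have [fd /IHk] := fD i.
Qed.

Lemma near_in U f g x : open U -> U x -> (forall y, U y -> f y = g y) ->
  \forall y \near x, f y = g y.
Proof.
by move=> oU Ux fg; apply: filterS (open_nbhs_nbhs (conj oU Ux)) => y /fg.
Qed.

Lemma Ck_eq k U f g : open U -> (forall x, U x -> f x = g x) ->
  Ck k U f -> Ck k U g.
Proof.
move=> oU; elim: k f g => [|k IHk] f g fg [fc fD].
all: have gc : continuous_in U g.
1,3: move=> x Ux; rewrite /prop_for /continuous_at -(fg x Ux).
1,2: exact: cvg_trans (near_eq_cvg (near_in oU Ux fg)) (fc x Ux).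
  by split.
split=> // i; have [fd fk] := fD i; split=> [x Ux|].
  exact: near_eq_derivable (near_in oU Ux fg) (fd x Ux).
apply: IHk fk => x Ux; exact: near_eq_derive (near_in oU Ux fg).
Qed.

Lemma Ck_cst k U (a : R) : open U -> Ck k U (fun=> a).
Proof.
have ac (b : R) : continuous_in U (fun=> b) by move=> x _; exact: cst_continuous.
move=> oU; elim: k a => [|k IHk] a; split=> //.
move=> i; split=> [x _|]; first exact: derivable_cst.
by apply: Ck_eq (IHk 0) => // x _; rewrite derive_cst.
Qed.

Lemma Ck_add k U f g : open U -> Ck k U f -> Ck k U g ->
  Ck k U (fun x => f x + g x).
Proof.
move=> oU; elim: k f g => [|k IHk] f g [fc fD] [gc gD].
all: have fgc : continuous_in U (fun x => f x + g x)
  by move=> x Ux; apply: continuousD; [exact: fc|exact: gc].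
  by split.
split=> //.
move=> i; have [fd fk] := fD i; have [gd gk] := gD i; split=> [x Ux|].
  by apply: derivableD; [exact: fd|exact: gd].
apply: Ck_eq (IHk _ _ fk gk) => // x Ux.
by rewrite deriveD; [|exact: fd|exact: gd].
Qed.

Lemma Ck_mul k U f g : open U -> Ck k U f -> Ck k U g ->
  Ck k U (fun x => f x * g x).
Proof.
move=> oU; elim: k f g => [|k IHk] f g Cf Cg.
all: have fgc : continuous_in U (fun x => f x * g x)
  by move=> x Ux; apply: continuousM;
     [exact: Ck_continuous Cf x Ux|exact: Ck_continuous Cg x Ux].
  by split.
split=> //.
have [_ fD] := Cf; have [_ gD] := Cg.
move=> i; have [fd fk] := fD i; have [gd gk] := gD i; split=> [x Ux|].
  by apply: derivableM; [exact: fd|exact: gd].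
apply: Ck_eq (Ck_add oU (IHk _ _ (Ck_weaken Cf) gk) (IHk _ _ (Ck_weaken Cg) fk)) => // x Ux.
by rewrite deriveM; [|exact: fd|exact: gd].
Qed.

End SmoothEuclidean.

Section Manifold.
Context (R : realType) (n : nat).

(* Only the values of chart_map on chart_dom, and of chart_inv on the image   *)
(* of chart_dom, are meaningful.                                              *)
Record chart (T : topologicalType) := Chart {
  chart_dom : set T;
  chart_map : T -> 'rV[R]_n;
  chart_inv : 'rV[R]_n -> T;
  chart_dom_open : open chart_dom;
  chart_img_open : open (chart_map @` chart_dom);
  chart_mapK : forall p, chart_dom p -> chart_inv (chart_map p) = p;
  chart_map_continuous :
    forall p, chart_dom p -> {for p, continuous chart_map};
  chart_inv_continuous :
    forall x, (chart_map @` chart_dom) x -> {for x, continuous chart_inv}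
}.

Definition smoothly_compatible (T : topologicalType) (c d : chart T) :=
  forall i, smooth_on (chart_map c @` (chart_dom c `&` chart_dom d))
                      (fun x => chart_map d (chart_inv c x) 0 i).

Record manifold := Manifold {
  points :> topologicalType;
  points_hausdorff : hausdorff_space points;
  points_second_countable : @second_countable points;
  atlas : set (chart points);
  atlas_cover : forall p, exists2 c, atlas c & chart_dom c p;
  atlas_compatible : forall c d, atlas c -> atlas d -> smoothly_compatible c d
}.

End Manifold.

Section SmoothFunctions.
Context {R : realType} {n : nat} (M : manifold R n).

Definition smooth (f : M -> R) : bool :=
  `[< forall c, atlas c ->
      smooth_on (chart_map c @` chart_dom c) (f \o chart_inv c) >].

Record Cinf := MkCinf { Cinf_fun :> M -> R; Cinf_smooth : smooth Cinf_fun }.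

HB.instance Definition _ := [isSub for Cinf_fun].
HB.instance Definition _ := [Choice of Cinf by <:].

Lemma smooth_cst (a : R) : smooth (fun=> a).
Proof. by apply/asboolP => c _ k; apply/Ck_cst/chart_img_open. Qed.

Fact smooth_subring_closed : subring_closed smooth.
Proof.
have sM : {in smooth &, forall f g, f * g \in smooth}.
  move=> f g /asboolP fs /asboolP gs; apply/asboolP => c Ac k.
  exact: Ck_mul (@chart_img_open _ _ _ c) (fs c Ac k) (gs c Ac k).
split=> //; first exact: smooth_cst.
move=> f g /asboolP fs gs.
have /asboolP gs' : (cst (-1) * g) \in smooth.
  by apply: sM => //; exact: smooth_cst.
rewrite -[- g]mulN1r.
apply/asboolP => c Ac k.
exact: Ck_add (@chart_img_open _ _ _ c) (fs c Ac k) (gs' c Ac k).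
Qed.

HB.instance Definition _ := GRing.isSubringClosed.Build _ smooth
  smooth_subring_closed.
HB.instance Definition _ :=
  GRing.SubChoice_isSubComPzRing.Build (M -> R) smooth Cinf smooth_subring_closed.

Definition Cinf_cst (a : R) : Cinf := MkCinf (smooth_cst a).

End SmoothFunctions.
Arguments Cinf {R n} M.
Arguments Cinf_cst {R n M} a.

Section VectorFields.
Context {R : realType} {n : nat} (M : manifold R n).

(* Smooth vector fields are the R-linear derivations of the algebra of smooth *)
(* functions.                                                                 *)
Definition derivation (X : Cinf M -> (Cinf M)^o) : bool :=
  `[< (forall (a : R) f h,
         X (Cinf_cst a * f + h) = Cinf_cst a * X f + X h) /\
      (forall f h, X (f * h) = f * X h + h * X f) >].

(* The regular module (Cinf M)^o makes the ambient function type a module     *)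
(* over Cinf M, so that (f *: X) h = f * X h.                                 *)
Record vfield := MkVfield {
  vfield_fun :> Cinf M -> (Cinf M)^o;
  vfield_derivation : derivation vfield_fun }.

HB.instance Definition _ := [isSub for vfield_fun].
HB.instance Definition _ := [Choice of vfield by <:].

Fact derivation_submod_closed : submod_closed derivation.
Proof.
have linE (c f u v w x : Cinf M) :
    f * (c * u + v) + (c * w + x) = c * (f * u + w) + (f * v + x).
  by rewrite !mulrDr addrACA mulrCA.
have leibE (f h k u v w x : Cinf M) :
    f * (h * u + k * v) + (h * w + k * x) = h * (f * u + w) + k * (f * v + x).
  by rewrite !mulrDr addrACA mulrCA (mulrCA f k).
split=> [|f X Y /asboolP[Xl XL] /asboolP[Yl YL]]; apply/asboolP; split.
- by move=> a h k; exact/esym/(etrans (addr0 _))/mulr0.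
- move=> h k; transitivity (h * 0 + k * 0 : Cinf M) => //.
  by rewrite !mulr0 addr0.
- move=> a h k; transitivity (f * X (Cinf_cst a * h + k)
                              + Y (Cinf_cst a * h + k) : Cinf M) => //.
  rewrite Xl Yl; exact: linE.
- move=> h k; transitivity (f * X (h * k) + Y (h * k) : Cinf M) => //.
  rewrite XL YL; exact: leibE.
Qed.

HB.instance Definition _ := GRing.isSubmodClosed.Build _ _ derivation
  derivation_submod_closed.
HB.instance Definition _ := [SubChoice_isSubLmodule of vfield by <:].


(* The Lie bracket h |-> X (Y h) - Y (X h). *)
Fact lie_derivation (X Y : vfield) :
  derivation (fun h => (X (Y h) : Cinf M) - (Y (X h) : Cinf M)).
Proof.
have /asboolP[Xl XL] := vfield_derivation X.
have /asboolP[Yl YL] := vfield_derivation Y.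
have Xadd (h k : Cinf M) : X (h + k) = X h + X k.
  have := Xl 1 h k; have -> : Cinf_cst 1 = 1 :> Cinf M by exact: val_inj.
  by rewrite !mul1r.
have Yadd (h k : Cinf M) : Y (h + k) = Y h + Y k.
  have := Yl 1 h k; have -> : Cinf_cst 1 = 1 :> Cinf M by exact: val_inj.
  by rewrite !mul1r.
have linE (c u v w x : Cinf M) :
    (c * u + v) - (c * w + x) = c * (u - w) + (v - x).
  by rewrite opprD addrACA mulrBr.
have leibE (h k x y xx yy : Cinf M) (hx hy kx ky : Cinf M) :
    h * x + ky * hx + (k * y + hy * kx) - (h * xx + kx * hy + (k * yy + hx * ky))
    = h * (x - xx) + k * (y - yy).
  rewrite (addrACA (h * x)) (addrACA (h * xx)).
  have -> : kx * hy + hx * ky = ky * hx + hy * kx.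
    by rewrite addrC (mulrC hx) (mulrC kx).
  rewrite opprD (addrACA (h * x + k * y)) subrr addr0 opprD addrACA.
  by rewrite !mulrBr.
apply/asboolP; split=> [a h k|h k].
  by rewrite Xl Yl Xl Yl; exact: linE.
by rewrite XL YL Xadd Yadd !XL !YL; exact: leibE.
Qed.

Definition lie_bracket (X Y : vfield) : vfield := MkVfield (lie_derivation X Y).

End VectorFields.
Arguments vfield {R n} M.

Section RiemannianGeometry.
Context {R : realType} {n : nat} (M : manifold R n).
Implicit Types X Y Z : vfield M.

(* Tensor fields are represented by the corresponding maps on vector fields   *)
(* which are linear over the smooth functions. The last two fields express    *)
(* that g is positive definite on every tangent space.                        *)
Record riemannian_metric := RiemannianMetric {
  metric :> vfield M -> vfield M -> Cinf M;
  metric_linear : forall Y, scalar (metric^~ Y);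
  metric_sym : forall X Y, metric X Y = metric Y X;
  metric_ge0 : forall X p, 0 <= metric X X p;
  metric_def : forall X p, metric X X p = 0 -> forall f, (X f : Cinf M) p = 0
}.

Record affine_connection := AffineConnection {
  nabla :> vfield M -> vfield M -> vfield M;
  nabla_linear : forall Y, linear (nabla^~ Y);
  nabla_add : forall X Y Z, nabla X (Y + Z) = nabla X Y + nabla X Z;
  nabla_leibniz : forall X (f : Cinf M) Y,
    nabla X (f *: Y) = (X f : Cinf M) *: Y + f *: nabla X Y
}.

Definition levi_civita (g : riemannian_metric) (D : affine_connection) : Prop :=
  (forall X Y, D X Y - D Y X = lie_bracket X Y) /\
  (forall X Y Z, X (g Y Z) = g (D X Y) Z + g Y (D X Z) :> Cinf M).

Record almost_contact_metric (phi : {linear vfield M -> vfield M})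
    (xi : vfield M) (eta : {scalar vfield M}) (g : riemannian_metric) : Prop :=
  AlmostContactMetric {
    phi_sqr : forall X, phi (phi X) = - X + eta X *: xi;
    eta_xi : eta xi = 1;
    phi_xi : phi xi = 0;
    eta_phi : forall X, eta (phi X) = 0;
    metric_phi : forall X Y, g (phi X) (phi Y) = g X Y - eta X * eta Y
  }.

(* (nabla_X phi) Y *)
Definition nabla_tensor (D : affine_connection)
    (phi : {linear vfield M -> vfield M}) X Y : vfield M :=
  D X (phi Y) - phi (D X Y).

Definition trans_sasakian (phi : {linear vfield M -> vfield M})
    (xi : vfield M) (eta : {scalar vfield M}) (g : riemannian_metric)
    (D : affine_connection) (alpha beta : Cinf M) : Prop :=
  forall X Y, nabla_tensor D phi X Y =
    alpha *: (g X Y *: xi - eta Y *: X) +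
    beta *: (g (phi X) Y *: xi - eta Y *: phi X).

(* A global frame: its value at every point is a basis of the tangent space,  *)
(* i.e. it spans the module of vector fields (independence follows from       *)
(* orthonormality).                                                           *)
Definition orthonormal_frame (g : riemannian_metric) (e : 'I_n -> vfield M) :
    Prop :=
  (forall i j, g (e i) (e j) = (i == j)%:R) /\
  (forall X, exists a : 'I_n -> Cinf M, X = \sum_i a i *: e i).

(* Sign convention: the rough Laplacian is minus the trace of the second      *)
(* covariant derivative.                                                      *)
Definition rough_laplacian (D : affine_connection) (e : 'I_n -> vfield M) X :
    vfield M :=
  - \sum_(i < n) (D (e i) (D (e i) X) - D (D (e i) (e i)) X).

End RiemannianGeometry.

Section Complexification.
Context {R : realType} {n : nat} {M : manifold R n}.

Local Notation Re := complex.Re.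
Local Notation Im := complex.Im.

(* Complex vector fields X + iY and complex smooth functions a + ib.          *)
Definition cvfield := complex (vfield M).
Definition cCinf := complex (Cinf M).
Implicit Types Z W : cvfield.

Definition cCinf_eval (f : cCinf) (p : M) : R[i] := (Re f p +i* Im f p)%C.

Definition cvfield_of X : cvfield := (X +i* 0)%C.

Definition cvscale (z : R[i]) Z : cvfield :=
  ((Cinf_cst (Re z) *: Re Z - Cinf_cst (Im z) *: Im Z) +i*
   (Cinf_cst (Re z) *: Im Z + Cinf_cst (Im z) *: Re Z))%C.

Definition cderiv Z (f : cCinf) : cCinf :=
  ((Re Z (Re f) - Im Z (Im f) : Cinf M) +i*
   (Re Z (Im f) + Im Z (Re f) : Cinf M))%C.

Definition cphi (phi : {linear vfield M -> vfield M}) Z : cvfield :=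
  (phi (Re Z) +i* phi (Im Z))%C.

Definition cmetric (g : riemannian_metric M) Z W : cCinf :=
  ((g (Re Z) (Re W) - g (Im Z) (Im W)) +i*
   (g (Re Z) (Im W) + g (Im Z) (Re W)))%C.

Definition cnabla (D : affine_connection M) Z W : cvfield :=
  ((D (Re Z) (Re W) - D (Im Z) (Im W)) +i*
   (D (Re Z) (Im W) + D (Im Z) (Re W)))%C.

End Complexification.
Arguments cvfield {R n} M.
Arguments cCinf {R n} M.

Section NewmanPenrose.
Context {R : realType} {M : manifold R 3}.
Implicit Types e xi : vfield M.

Definition frame3 e1 e2 xi : 'I_3 -> vfield M := tnth [tuple e1; e2; xi].

Definition np_del e1 e2 : cvfield M :=
  cvscale (Num.sqrt 2)^-1%:C%C (e1 +i* - e2)%C.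
Definition np_delbar e1 e2 : cvfield M :=
  cvscale (Num.sqrt 2)^-1%:C%C (e1 +i* e2)%C.

Definition np_frame (phi : {linear vfield M -> vfield M}) xi
    (g : riemannian_metric M) e1 e2 : Prop :=
  [/\ orthonormal_frame g (frame3 e1 e2 xi),
      cphi phi (np_del e1 e2) = cvscale 'i%C (np_del e1 e2) &
      cphi phi (np_delbar e1 e2) = cvscale (- 'i)%C (np_delbar e1 e2)].

Definition rho_np (g : riemannian_metric M) (D : affine_connection M)
    xi e1 e2 : cCinf M :=
  cmetric g (np_del e1 e2) (cnabla D (np_delbar e1 e2) (cvfield_of xi)).

End NewmanPenrose.

(* Main.v *)
(* The trans-Sasakian identity with Y = xi gives                              *)
(* D X xi = beta (X - eta(X) xi) - alpha phi X. Differentiating it once more  *)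
(* along a horizontal unit field X, the phi (D X X) terms cancel and          *)
(* D X (D X xi) - D (D X X) xi                                                *)
(*   = X(beta) X - X(alpha) phi X - (alpha^2 + beta^2) xi,                    *)
(* while the xi-direction contributes nothing since D xi xi = 0. Summing over *)
(* X = e1, e2 gives Delta xi = 2 (alpha^2 + beta^2) xi                        *)
(*   - (e1(beta) + e2(alpha)) e1 - (e2(beta) - e1(alpha)) e2,                 *)
(* and rho = beta + i alpha, so the two horizontal coefficients are, up to    *)
(* sign and sqrt 2, the real and imaginary parts of the derivative of rho.    *)
Require Import Defs.
From mathcomp Require Import all_boot all_order all_algebra.
From mathcomp Require Import all_classical all_reals all_analysis.
From mathcomp Require Import complex ring.
Import Order.TTheory GRing.Theory Num.Theory.
Local Open Scope ring_scope.

(** All first-order data of [xi] is in [nabla_xi]: on horizontal vectors, X maps to [D X xi] as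
    multiplication by beta - i alpha, with [phi] as the imaginary unit. Hence the second derivatives
    in [second_derivative_xi] involve only the derivatives of alpha and beta, plus the vertical term
    - (alpha^2 + beta^2) xi. The trace, [rough_laplacian_xi], therefore has a vertical coefficient
    equal to twice the squared modulus of rho ([rho_npE]), and horizontal coefficients which are the
    Cauchy-Riemann expressions of rho, that is, the two parts of its derivative along del
    ([del_rho_npE]). Pairing with the orthonormal frame separates these coefficients. *)

Section VectorFieldFacts.
Context {R : realType} {n : nat} {M : manifold R n}.
Implicit Types (X Y Z : vfield M) (f h : Cinf M) (a b : R).

(** * Algebra of vector fields, metrics and connections over the smooth functions *)

Lemma vfield_ext X Y : (forall f, X f = Y f :> Cinf M) -> X = Y.
Proof. by move=> XY; apply/val_inj/funext. Qed.

Lemma vfieldD X Y f : ((X + Y) f : Cinf M) = X f + Y f.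
Proof. by []. Qed.

Lemma vfieldN X f : ((- X) f : Cinf M) = - (X f : Cinf M).
Proof. by []. Qed.

Lemma vfieldZ h X f : ((h *: X) f : Cinf M) = h * (X f : Cinf M).
Proof. by []. Qed.

Lemma vfield0 f : ((0 : vfield M) f : Cinf M) = 0.
Proof. by []. Qed.

Definition vfieldE := (vfieldD, vfieldN, vfieldZ, vfield0).

Lemma vfield_1 X : (X 1 : Cinf M) = 0.
Proof.
have /asboolP[_ XL] := vfield_derivation X.
have := XL 1 1; rewrite !mul1r => X1.
by apply: (addrI (X 1 : Cinf M)); rewrite addr0 -X1.
Qed.

Lemma Cinf_ext f h : (forall p, f p = h p) -> f = h.
Proof. by move=> fh; apply/val_inj/funext. Qed.

Lemma Cinf_cstM a b : Cinf_cst a * Cinf_cst b = Cinf_cst (a * b) :> Cinf M.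
Proof. exact: val_inj. Qed.

Lemma Cinf_cst1 : Cinf_cst 1 = 1 :> Cinf M.
Proof. exact: val_inj. Qed.

Lemma Cinf_cst0 : Cinf_cst 0 = 0 :> Cinf M.
Proof. exact: val_inj. Qed.

(** Turns skew-symmetry into vanishing on the diagonal. *)
Lemma Cinf_double_eq0 f : f + f = 0 -> f = 0.
Proof.
move=> ff; apply: Cinf_ext => p.
have /eqP : (f + f) p = 0 by rewrite ff.
by rewrite -[(f + f) p]/(f p + f p) -mulr2n mulrn_eq0 => /eqP.
Qed.

Lemma cst_vfield_inj a X Y : a != 0 ->
  Cinf_cst a *: X = Cinf_cst a *: Y -> X = Y.
Proof.
move=> a0 /(congr1 (fun Z => Cinf_cst a^-1 *: Z)).
by rewrite !scalerA Cinf_cstM mulVf// Cinf_cst1 !scale1r.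
Qed.

Variable g : riemannian_metric M.

Lemma metricDl X Y Z : g (X + Y) Z = g X Z + g Y Z.
Proof. by have := metric_linear g Z 1 X Y; rewrite !scale1r mul1r. Qed.

Lemma metric0l Z : g 0 Z = 0.
Proof. by apply: (addrI (g 0 Z)); rewrite -metricDl !addr0. Qed.

Lemma metricZl f X Z : g (f *: X) Z = f * g X Z.
Proof.
by have := metric_linear g Z f X 0; rewrite !addr0 => ->;
   rewrite metric0l addr0.
Qed.

Lemma metricNl X Z : g (- X) Z = - g X Z.
Proof. by rewrite -scaleN1r metricZl mulN1r. Qed.

Lemma metricDr X Y Z : g Z (X + Y) = g Z X + g Z Y.
Proof. by rewrite !(Defs.metric_sym g Z) metricDl. Qed.

Lemma metric0r Z : g Z 0 = 0.
Proof. by rewrite Defs.metric_sym metric0l. Qed.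

Lemma metricZr f X Z : g Z (f *: X) = f * g Z X.
Proof. by rewrite !(Defs.metric_sym g Z) metricZl. Qed.

Lemma metricNr X Z : g Z (- X) = - g Z X.
Proof. by rewrite !(Defs.metric_sym g Z) metricNl. Qed.

Definition metricE := (metricDl, metricNl, metricZl, metric0l,
                       metricDr, metricNr, metricZr, metric0r).

Variable D : affine_connection M.

Lemma nablaDl X Y Z : D (X + Y) Z = D X Z + D Y Z.
Proof. by have := nabla_linear D Z 1 X Y; rewrite !scale1r. Qed.

Lemma nabla0l Z : D 0 Z = 0.
Proof. by apply: (addrI (D 0 Z)); rewrite -nablaDl !addr0. Qed.

Lemma nablaZl f X Z : D (f *: X) Z = f *: D X Z.
Proof.
by have := nabla_linear D Z f X 0; rewrite !addr0 => ->; rewrite nabla0l addr0.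
Qed.

Lemma nabla0r Z : D Z 0 = 0.
Proof. by apply: (addrI (D Z 0)); rewrite -nabla_add !addr0. Qed.

Lemma nablaNr X Z : D Z (- X) = - D Z X.
Proof. by apply: (addrI (D Z X)); rewrite -nabla_add !subrr nabla0r. Qed.

End VectorFieldFacts.

(** * Covariant derivatives of the structure field *)

Section TransSasakian.
Context {R : realType} {n : nat} {M : manifold R n}.
Context {phi : {linear vfield M -> vfield M}} {xi : vfield M}.
Context {eta : {scalar vfield M}} {g : riemannian_metric M}.
Context {D : affine_connection M} {alpha beta : Cinf M}.
Hypothesis acm : almost_contact_metric phi xi eta g.
Hypothesis lc : levi_civita g D.
Hypothesis ts : trans_sasakian phi xi eta g D alpha beta.
Implicit Types X Y : vfield M.

Lemma eta_metric X : eta X = g X xi.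
Proof.
have /eqP := metric_phi acm X xi.
by rewrite (phi_xi acm) metric0r (eta_xi acm) mulr1 eq_sym subr_eq0 => /eqP.
Qed.

(** [phi] is skew-adjoint: [metric_phi] at X and [phi X], with [phi_sqr], makes this function equal
    to its own opposite. *)
Lemma metric_phi_self X : g (phi X) X = 0.
Proof.
apply: Cinf_double_eq0.
have := metric_phi acm X (phi X).
rewrite (phi_sqr acm) (eta_phi acm) mulr0 subr0 !metricE -eta_metric.
rewrite (eta_phi acm) mulr0 addr0 (Defs.metric_sym g X) => E.
by rewrite -{1}E addNr.
Qed.

(** Differentiate the constant g(xi, xi) = 1. *)
Lemma nabla_xi_horizontal X : g (D X xi) xi = 0.
Proof.
apply: Cinf_double_eq0.
by rewrite {2}Defs.metric_sym -(lc.2 X xi xi) -eta_metric (eta_xi acm) vfield_1.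
Qed.

Lemma nabla_xi X : D X xi = beta *: (X - eta X *: xi) - alpha *: phi X.
Proof.
have := ts X xi; rewrite /nabla_tensor (phi_xi acm) nabla0r sub0r (eta_xi acm).
rewrite -!eta_metric (eta_phi acm) scale0r sub0r !scale1r.
(* So far only [phi (D X xi)] is known. Since [D X xi] is horizontal, a second [phi] recovers it up
   to sign. *)
move/(congr1 phi); rewrite [phi (- _)]linearN (phi_sqr acm) eta_metric.
rewrite nabla_xi_horizontal scale0r addr0 opprK => ->.
rewrite linearD !linearZ /= linearB linearN /= linearZ /= (phi_xi acm).
rewrite (phi_sqr acm) scaler0 sub0r opprD opprK.
by rewrite [LHS]addrC scalerN.
Qed.

Lemma nabla_xi_xi : D xi xi = 0.
Proof.
by rewrite nabla_xi (eta_xi acm) (phi_xi acm) scale1r subrr !scaler0 subrr.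
Qed.

Lemma second_derivative_xi X : eta X = 0 -> g X X = 1 ->
  D X (D X xi) - D (D X X) xi =
  (X beta : Cinf M) *: X - (X alpha : Cinf M) *: phi X
  - (alpha ^+ 2 + beta ^+ 2) *: xi.
Proof.
move=> eX gX.
have DX : D X xi = beta *: X - alpha *: phi X.
  by rewrite nabla_xi eX scale0r subr0.
(* Differentiate g(X, xi) = 0 along X. *)
have eDXX : eta (D X X) = - beta.
  apply/eqP; rewrite -addr_eq0 eta_metric; apply/eqP.
  have := lc.2 X X xi; rewrite -eta_metric eX DX !metricE gX.
  rewrite (Defs.metric_sym g X) metric_phi_self.
  have -> : (X 0 : Cinf M) = 0.
    have /asboolP[_ XL] := vfield_derivation X.
    by have := XL 0 0; rewrite !mul0r addr0.
  by move=> ->; ring.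
(* For a horizontal unit X, the trans-Sasakian identity at (X, X) reduces to alpha xi. *)
have Dphi : D X (phi X) = phi (D X X) + alpha *: xi.
  have := ts X X; rewrite /nabla_tensor gX eX metric_phi_self !scale0r.
  by rewrite !subr0 scaler0 addr0 scale1r => /eqP;
     rewrite subr_eq addrC => /eqP.
rewrite DX nabla_add nablaNr !nabla_leibniz Dphi [D (D X X) xi]nabla_xi eDXX.
by apply: vfield_ext => f; rewrite !vfieldE; ring.
Qed.

End TransSasakian.

(** * The Laplacian and rho in the Newman-Penrose frame *)

Section NewmanPenroseFrame.
Context {R : realType} {M : manifold R 3}.
Context {phi : {linear vfield M -> vfield M}} {xi : vfield M}.
Context {eta : {scalar vfield M}} {g : riemannian_metric M}.
Context {D : affine_connection M} {alpha beta : Cinf M} {e1 e2 : vfield M}.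
Hypothesis acm : almost_contact_metric phi xi eta g.
Hypothesis lc : levi_civita g D.
Hypothesis ts : trans_sasakian phi xi eta g D alpha beta.
Hypothesis np : np_frame phi xi g e1 e2.

Let r : Cinf M := Cinf_cst (Num.sqrt 2)^-1.

Lemma np_frame_orthonormal : [/\ [/\ g e1 e1 = 1, g e2 e2 = 1 & g xi xi = 1],
  g e1 e2 = 0, g e1 xi = 0 & g e2 xi = 0].
Proof.
case: np => -[eE _] _ _.
pose i0 : 'I_3 := @Ordinal 3 0 isT; pose i1 : 'I_3 := @Ordinal 3 1 isT.
pose i2 : 'I_3 := @Ordinal 3 2 isT.
split; first split.
- exact: (eE i0 i0).
- exact: (eE i1 i1).
- exact: (eE i2 i2).
- exact: (eE i0 i1).
- exact: (eE i0 i2).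
- exact: (eE i1 i2).
Qed.

Lemma np_delE : np_del e1 e2 = ((r *: e1) +i* (- (r *: e2)))%C.
Proof.
by rewrite /np_del /cvscale /= Cinf_cst0 !scale0r subr0 addr0 scalerN.
Qed.

Lemma np_delbarE : np_delbar e1 e2 = ((r *: e1) +i* (r *: e2))%C.
Proof. by rewrite /np_delbar /cvscale /= Cinf_cst0 !scale0r subr0 addr0. Qed.

Lemma np_phi_e1 : phi e1 = e2.
Proof.
(* The real part of phi(del) = i del is phi(r e1) = r e2, and the nonzero constant r cancels. *)
case: np => _ /(congr1 (@complex.Re _)) + _.
rewrite np_delE /= linearZ /= Cinf_cst0 Cinf_cst1 scale0r sub0r scale1r opprK.
by apply: cst_vfield_inj; rewrite invr_eq0 sqrtr_eq0 -ltNge ltr0n.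
Qed.

Lemma np_phi_e2 : phi e2 = - e1.
Proof.
have [_ _ e1xi _] := np_frame_orthonormal.
by rewrite -np_phi_e1 (phi_sqr acm) (eta_metric acm) e1xi scale0r addr0.
Qed.

Lemma rough_laplacian_xi : rough_laplacian D (frame3 e1 e2 xi) xi =
  (2 * (alpha ^+ 2 + beta ^+ 2)) *: xi
  - ((e1 beta : Cinf M) + e2 alpha) *: e1
  - ((e2 beta : Cinf M) - e1 alpha) *: e2.
Proof.
have [[e11 e22 _] _ e1xi e2xi] := np_frame_orthonormal.
have e1h : eta e1 = 0 by rewrite (eta_metric acm).
have e2h : eta e2 = 0 by rewrite (eta_metric acm).
rewrite /rough_laplacian !big_ord_recl big_ord0 /frame3 /=.
rewrite -[tnth _ _]/e1 -[tnth _ (lift _ _)]/e2 -[tnth _ _]/xi.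
rewrite (second_derivative_xi acm lc ts _ e1h e11).
rewrite (second_derivative_xi acm lc ts _ e2h e22).
rewrite (nabla_xi_xi acm lc ts) nabla0r nabla0l np_phi_e1 np_phi_e2.
by apply: vfield_ext => f; rewrite !vfieldE; ring.
Qed.

Lemma sqr_inv_sqrt2 : 2 * r ^+ 2 = 1.
Proof.
apply: Cinf_ext => p; rewrite mulr2n mulrDl mul1r.
rewrite -[LHS]/((Num.sqrt 2)^-1 * (Num.sqrt 2)^-1 +
               (Num.sqrt 2)^-1 * (Num.sqrt 2)^-1 :> R).
by rewrite -invfM -expr2 sqr_sqrtr ?ler0n // -[LHS]mulr2n
   -[LHS]mulr_natl mulfV ?pnatr_eq0.
Qed.

Lemma rho_npE : rho_np g D xi e1 e2 = (beta +i* alpha)%C.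
Proof.
have [[e11 e22 _] e12 e1xi e2xi] := np_frame_orthonormal.
have e21 : g e2 e1 = 0 by rewrite Defs.metric_sym.
have De1 : D e1 xi = beta *: e1 - alpha *: e2.
  by rewrite (nabla_xi acm lc ts) (eta_metric acm) e1xi scale0r subr0 np_phi_e1.
have De2 : D e2 xi = beta *: e2 + alpha *: e1.
  rewrite (nabla_xi acm lc ts) (eta_metric acm) e2xi scale0r subr0 np_phi_e2.
  by rewrite scalerN opprK.
rewrite /rho_np np_delE np_delbarE /cnabla /cmetric /=.
rewrite !nabla0r !nablaZl De1 De2 subr0 add0r !metricE e11 e22 e12 e21.
congr (_ +i* _)%C.
- by transitivity (2 * r ^+ 2 * beta); [ring|rewrite sqr_inv_sqrt2 mul1r].
- by transitivity (2 * r ^+ 2 * alpha); [ring|rewrite sqr_inv_sqrt2 mul1r].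
Qed.

(** Expand r (e1 - i e2)(beta + i alpha). Up to the factor r and signs, the two parts are the
    horizontal coefficients in [rough_laplacian_xi]. *)
Lemma del_rho_npE : cderiv (np_del e1 e2) (rho_np g D xi e1 e2) =
  ((r * ((e1 beta : Cinf M) + e2 alpha)) +i*
   (- (r * ((e2 beta : Cinf M) - e1 alpha))))%C.
Proof.
by rewrite rho_npE np_delE /cderiv; cbn [complex.Re complex.Im];
   congr (_ +i* _)%C; rewrite !vfieldE; ring.
Qed.

Lemma del_rho_np_eq0 :
  (forall p : M, cCinf_eval (cderiv (np_del e1 e2) (rho_np g D xi e1 e2)) p = 0)
  <-> (e1 beta : Cinf M) + e2 alpha = 0 /\ (e2 beta : Cinf M) - e1 alpha = 0.
Proof.
have rI (f : Cinf M) p : (r * f) p = 0 -> f p = 0.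
  move/eqP; rewrite -[(r * f) p]/((Num.sqrt 2)^-1 * f p).
  by rewrite mulf_eq0 invr_eq0 sqrtr_eq0 leNgt ltr0n /= => /eqP.
rewrite del_rho_npE; split=> [H|[-> ->] p]; last by rewrite mulr0 oppr0.
have {}H p : (r * ((e1 beta : Cinf M) + e2 alpha)) p = 0 /\
             (r * ((e2 beta : Cinf M) - e1 alpha)) p = 0.
  by case: (H p) => u v; split; [exact: u|apply/oppr_inj/(etrans v)/esym/oppr0].
by split; apply: Cinf_ext => p; have [u v] := H p;
   [exact: rI u|exact: rI v].
Qed.

(** Stating this for a fixed [lambda] gives both the existence criterion and the forced value.
    Pairing with [e1], [e2] and [xi] yields the three conditions in turn. *)
Lemma rough_laplacian_xi_collinear (lambda : Cinf M) :
  rough_laplacian D (frame3 e1 e2 xi) xi = lambda *: xi <->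
  [/\ (e1 beta : Cinf M) + e2 alpha = 0, (e2 beta : Cinf M) - e1 alpha = 0
    & lambda = 2 * (alpha ^+ 2 + beta ^+ 2)].
Proof.
have [[e11 e22 xixi] e12 e1xi e2xi] := np_frame_orthonormal.
rewrite rough_laplacian_xi.
split=> [E|[-> -> ->]]; last by rewrite !scale0r !subr0.
have gE := congr1 (fun X => g X _) E.
split.
- have := gE e1; rewrite !metricE e11 !(Defs.metric_sym g _ e1) e12 e1xi !mulr0.
  by rewrite mulr1 sub0r subr0 => /eqP; rewrite oppr_eq0 => /eqP.
- have := gE e2; rewrite !metricE e22 e12 (Defs.metric_sym g xi) e2xi !mulr0.
  by rewrite mulr1 !sub0r oppr0 add0r => /eqP; rewrite oppr_eq0 => /eqP.
- by have := gE xi; rewrite !metricE xixi e1xi e2xi !mulr0 !mulr1 !subr0 => ->.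
Qed.

End NewmanPenroseFrame.

Theorem theorem5p6 (R : realType) (M : manifold R 3)
    (phi : {linear vfield M -> vfield M}) (xi : vfield M)
    (eta : {scalar vfield M}) (g : riemannian_metric M)
    (D : affine_connection M) (alpha beta : Cinf M) (e1 e2 : vfield M)
    (acm : almost_contact_metric phi xi eta g)
    (lc : levi_civita g D)
    (ts : trans_sasakian phi xi eta g D alpha beta)
    (np : np_frame phi xi g e1 e2) :
  let Delta_xi := rough_laplacian D (frame3 e1 e2 xi) xi in
  let rho := rho_np g D xi e1 e2 in
  ((exists lambda : Cinf M, Delta_xi = lambda *: xi) <->
   (forall p : M, cCinf_eval (cderiv (np_del e1 e2) rho) p = 0)) /\
  (forall lambda : Cinf M, Delta_xi = lambda *: xi ->
   forall p : M, (lambda p)%:C%C = 2 * `|cCinf_eval rho p| ^+ 2).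
Proof.
move=> Delta_xi rho; rewrite {}/Delta_xi {}/rho.
have lapE := rough_laplacian_xi_collinear acm lc ts np.
split.
  rewrite (del_rho_np_eq0 acm lc ts np); split=> [[lambda /lapE[]]|[u v]] //.
  by exists (2 * (alpha ^+ 2 + beta ^+ 2)); apply/lapE.
move=> lambda /lapE[_ _ ->] p; rewrite (rho_npE acm lc ts np).
rewrite -add_Re2_Im2 /= -(rmorph_nat (real_complex R) 2) -rmorphM /=.
by apply: (congr1 (real_complex R)); rewrite [beta p ^+ 2 + _]addrC.
Qed.
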